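(* Let $m,n\ge1$ be integers, $G=\{0,\dots,m-1\}\times\{0,\dots,n-1\}$ the $m\times n$ rectangular graph, $c=\gcd(m+1,n+1)-1$, and let $\beta,\omega$ be the dimensions of $\ker BW_{m,n}$ and $\ker WB_{m,n}$. Let $v\in\ker BW_{m,n}$ (resp. $v\in\ker WB_{m,n}$). Then: (i) $v$ vanishes identically on the grid $\mathcal{G}$; (ii) the restriction of $v$ to each fundamental square $S$ lies in the kernel of the black-to-white (resp. white-to-black) adjacency map of the subgraph of $G$ induced on $S$, with colors inherited from $G$; (iii) if $S_1,S_2$ are two fundamental squares separated by a common row $y=y_0$ or column $x=x_0$ of $\mathcal{G}$, then the restrictions of $v$ to $S_1$ and $S_2$ are mirror images of each other with respect to that row or column, i.e. $v(p)=v(p')$ for $p\in S_1$, where $p'\in S_2$ is the reflection of $p$ across that line; (iv) $\beta=\dim\ker BW_{c,c}$ and $\omega=\dim\ker WB_{c,c}$.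
   Context: Points $(x,y),(x',y')$ of a rectangular graph are adjacent iff $|x-x'|+|y-y'|=1$; a point is black if $x+y$ is even and white otherwise. For the $p\times q$ rectangular graph $\{0,\dots,p-1\}\times\{0,\dots,q-1\}$, $BW_{p,q}$ is the linear map over $\mathbb{Z}/(2)$ sending a function $u$ on black points to the function on white points $w\mapsto\sum_{b\text{ black neighbor of }w}u(b)\pmod 2$, and $WB_{p,q}$ is defined symmetrically from white points to black points (for $c=0$ the $0\times0$ graph is empty and these kernels are $0$). The grid $\mathcal{G}$ of $G$ is the set of points of $G$ lying on a horizontal line $y=k(c+1)-1$ or a vertical line $x=k(c+1)-1$ for some integer $k$. Since $c+1$ divides $m+1$ and $n+1$, $G\setminus\mathcal{G}$ is the disjoint union of the $c\times c$ squares $\{k(c+1),\dots,k(c+1)+c-1\}\times\{l(c+1),\dots,l(c+1)+c-1\}$ contained in $G$; these are the fundamental squares. *)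

(* Defs.v *)
From HB Require Import structures.
From mathcomp Require Import all_boot all_order all_algebra.

Set Implicit Arguments.
Unset Strict Implicit.
Unset Printing Implicit Defensive.
Import Order.TTheory GRing.Theory Num.Theory.
Local Open Scope ring_scope.

(* The vertices (x, y) of the p x q rectangular graph. *)
Notation point p q := ('I_p * 'I_q)%type.

Definition adjacent p q (P Q : point p q) : bool :=
  `|P.1%:Z - Q.1%:Z| + `|P.2%:Z - Q.2%:Z| == 1.

(* A color is the parity of x + y. *)
Definition black : bool := false.
Definition white : bool := true.
Definition color p q (P : point p q) : bool := odd (P.1 + P.2).

(* The points of color [b] in a set [S] of vertices. Colors are always those of
   the ambient graph, also when [S] is a proper subset. *)
Definition colored p q (b : bool) (S : {set point p q}) : Type :=
  {P : point p q | (P \in S) && (color P == b)}.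

HB.instance Definition _ p q b (S : {set point p q}) :=
  SubFinite.copy (colored b S) {P : point p q | (P \in S) && (color P == b)}.

Notation colored_fun b S := {ffun colored b S -> ('F_2)^o}.

Section AdjacencyMap.
Variables (p q : nat) (b : bool) (S : {set point p q}).

Definition adj_fun (u : colored_fun b S) : colored_fun (~~ b) S :=
  [ffun w => \sum_(a : colored b S | adjacent (val a) (val w)) u a].

Fact adj_fun_is_linear : linear adj_fun.
Proof.
move=> a u v; apply/ffunP=> w; rewrite !ffunE scaler_sumr -big_split /=.
by apply: eq_bigr => i _; rewrite !ffunE.
Qed.

HB.instance Definition _ :=
  GRing.isLinear.Build 'F_2 (colored_fun b S) (colored_fun (~~ b) S) _
    adj_fun adj_fun_is_linear.

(* From color [b] to the opposite color, in the subgraph induced on [S]. *)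
Definition adj_map : 'Hom(colored_fun b S, colored_fun (~~ b) S) :=
  linfun adj_fun.

Lemma adj_mapE (u : colored_fun b S) (w : colored (~~ b) S) :
  adj_map u w = \sum_(a : colored b S | adjacent (val a) (val w)) u a.
Proof. by rewrite /adj_map lfunE /= ffunE. Qed.

Fact colored_inT (P : colored b S) :
  (val P \in [set: point p q]) && (color (val P) == b).
Proof. by rewrite inE /=; case/andP: (valP P). Qed.

Definition restriction (v : colored_fun b [set: point p q]) : colored_fun b S :=
  [ffun P : colored b S => v (Sub (val P) (colored_inT P))].

End AdjacencyMap.

Definition BW p q := adj_map black [set: point p q].
Definition WB p q := adj_map white [set: point p q].

Section Grid.
Variables m n : nat.

(* The number [c]; the gcd is positive, so [c.+1] is the gcd itself. *)
Definition csize : nat := (gcdn m.+1 n.+1).-1.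
Local Notation c := csize.

Definition on_grid (P : point m n) : Prop :=
  exists k : int, P.2%:Z = k * c.+1%:Z - 1 \/ P.1%:Z = k * c.+1%:Z - 1.

Definition square (k l : nat) : {set point m n} :=
  [set P : point m n | (k * c.+1 <= P.1 < k * c.+1 + c)%N
                    && (l * c.+1 <= P.2 < l * c.+1 + c)%N].

(* [square k l] is by typing cut down to the graph; the bounds say that the
   whole c x c square fits. *)
Definition square_fits (k l : nat) : bool :=
  (k * c.+1 + c <= m)%N && (l * c.+1 + c <= n)%N.

Definition fundamental (S : {set point m n}) : Prop :=
  exists k l : nat, square_fits k l /\ S = square k l.

(* The two squares are the neighbours of one another on the two sides of the
   grid row y = y0 (resp. grid column x = x0), in either order. *)
Definition separated_by_row (y0 : nat) (S1 S2 : {set point m n}) : Prop :=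
  exists k l : nat,
    [/\ square_fits k l, square_fits k l.+1, y0 = (l.+1 * c.+1).-1
      & (S1 = square k l /\ S2 = square k l.+1) \/
        (S1 = square k l.+1 /\ S2 = square k l)].

Definition separated_by_column (x0 : nat) (S1 S2 : {set point m n}) : Prop :=
  exists k l : nat,
    [/\ square_fits k l, square_fits k.+1 l, x0 = (k.+1 * c.+1).-1
      & (S1 = square k l /\ S2 = square k.+1 l) \/
        (S1 = square k.+1 l /\ S2 = square k l)].

Definition row_mirror (y0 : nat) (P P' : point m n) : Prop :=
  P'.1 = P.1 /\ P'.2%:Z = 2 * y0%:Z - P.2%:Z.

Definition column_mirror (x0 : nat) (P P' : point m n) : Prop :=
  P'.1%:Z = 2 * x0%:Z - P.1%:Z /\ P'.2 = P.2.

End Grid.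

(* Main.v *)
(* Shift the coordinates by one and let M = m + 1, N = n + 1. A kernel vector
   vanishes on the lines X = 0, X = M, Y = 0, Y = N, so its unfolding by
   reflections solves the mod 2 wave equation on the whole plane. D'Alembert's
   formula then writes it as a standing wave a (X + Y) + a (X - Y) with a even;
   vanishing on X = M and Y = N makes a periodic with periods 2M and 2N, hence
   with period 2g for g = gcd (M, N). Conversely every even 2g-periodic a gives a
   kernel vector, so the kernel depends on g only, and the zeros and symmetries
   of the standing wave give the grid and the mirror images. *)
Require Import Defs.
From HB Require Import structures.
From mathcomp Require Import all_boot all_order all_algebra.
From mathcomp Require Import zify.

Set Implicit Arguments.
Unset Strict Implicit.
Unset Printing Implicit Defensive.
Import Order.TTheory GRing.Theory Num.Theory.
Local Open Scope ring_scope.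

(** * Folding the integers onto the interval from 0 to M *)

Section Fold.
Variable M : nat.
Hypothesis M_gt0 : (0 < M)%N.

(* The distance from X to the nearest multiple of 2M. *)
Definition fold (X : int) : nat :=
  let r := `|(X %% (2 * M%:Z))%Z|%N in if (r <= M)%N then r else (2 * M - r)%N.

Lemma foldP (X : int) : exists q : int,
  (fold X <= M)%N /\
  (X = q * (2 * M%:Z) + (fold X)%:Z \/ X = q * (2 * M%:Z) - (fold X)%:Z).
Proof.
have H0 : 2 * M%:Z != 0 by lia.
have := divz_eq X (2 * M%:Z); have := modz_ge0 X H0.
have : (X %% (2 * M%:Z))%Z < 2 * M%:Z by apply: ltz_pmod; lia.
rewrite /fold; set r := (X %% _)%Z; set q := (X %/ _)%Z => h1 h2 ->.
case: ifP => h; first by exists q; split; [|left; lia].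
by exists (q + 1); split; [lia | right; lia].
Qed.

Lemma fold_le X : (fold X <= M)%N.
Proof. by have [q []] := foldP X. Qed.

Lemma foldDM (q X : int) : fold (q * (2 * M%:Z) + X) = fold X.
Proof. by rewrite /fold modzMDl. Qed.

Lemma fold_small (f : nat) : (f <= M)%N -> fold f%:Z = f.
Proof.
move=> h; rewrite /fold modz_small; last lia.
by rewrite absz_nat h.
Qed.

Lemma foldN X : fold (- X) = fold X.
Proof.
suff H (f : nat) : (f <= M)%N -> fold (- f%:Z) = f.
  have [q [hf [] {1}->]] := foldP X.
    by rewrite opprD -mulNr foldDM H.
  by rewrite opprB addrC -mulNr foldDM fold_small.
move=> hf; case: (posnP f) => [->|f0]; first by rewrite oppr0 fold_small.
rewrite -(foldDM 1) mul1r /fold modz_small; last lia.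
case: ifP; lia.
Qed.

Lemma fold_sub (q X : int) : fold (q * (2 * M%:Z) - X) = fold X.
Proof. by rewrite foldDM foldN. Qed.

Lemma fold_eq (q X : int) (f : nat) : (f <= M)%N ->
  X = q * (2 * M%:Z) + f%:Z \/ X = q * (2 * M%:Z) - f%:Z -> fold X = f.
Proof. by move=> hf [] ->; rewrite ?fold_sub ?foldDM fold_small. Qed.

(** [fold] has slope 1 or -1 between turning points, according to the branch of [foldP], so it sends
    the neighbours of X to those of [fold X]. *)
Lemma fold_step X : (0 < fold X < M)%N ->
  (fold (X + 1) = (fold X).+1 /\ fold (X - 1) = (fold X).-1) \/
  (fold (X + 1) = (fold X).-1 /\ fold (X - 1) = (fold X).+1).
Proof.
case/andP; have [q [_ ]] := foldP X; move: (fold X) => f [] e h1 h2.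
  by left; split; apply: (@fold_eq q); lia.
by right; split; apply: (@fold_eq q); lia.
Qed.

(** A turning point is a multiple of M, so 2X is a multiple of the period 2M, and X + 1 = 2X - (X -
    1) is a mirror image of X - 1. *)
Lemma fold_turn X : fold X = 0%N \/ fold X = M -> fold (X + 1) = fold (X - 1).
Proof.
have [q [_ ]] := foldP X; move: (fold X) => f e H.
have [r er] : exists r : int, X + X = r * (2 * M%:Z).
  case: H e => -> e; first by exists (2 * q); lia.
  by case: e => e; [exists (2 * q + 1)|exists (2 * q - 1)]; lia.
rewrite -(fold_sub r (X - 1)) -er; congr fold; lia.
Qed.

End Fold.

(** * Periods of functions on the integers *)

Section Periodic.
Variables (T : Type) (a : int -> T).

Definition periodic (t : int) := forall X, a (X + t) = a X.

Lemma periodic_mul t (k : int) : periodic t -> periodic (k * t).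
Proof.
move=> H.
have Hn (n : nat) X : a (X + n%:Z * t) = a X.
  elim: n => [|n IH]; first by rewrite mul0r addr0.
  by rewrite (_ : _ + _ = X + n%:Z * t + t) ?H //; lia.
move=> X; case: k => n; first exact: Hn.
by rewrite -(Hn n.+1) NegzE mulNr subrK.
Qed.

Lemma periodic_gcd (M N : nat) : periodic (2 * M%:Z) -> periodic (2 * N%:Z) ->
  periodic (2 * (gcdn M N)%:Z).
Proof.
move=> HM HN X; have [u [v e]] := Bezoutz M%:Z N%:Z.
have -> : X + 2 * (gcdn M N)%:Z = X + u * (2 * M%:Z) + v * (2 * N%:Z).
  by move: e; rewrite /gcdz !absz_nat; lia.
by rewrite !(periodic_mul _ HM, periodic_mul _ HN).
Qed.

End Periodic.

(** * The mod 2 wave equation and d'Alembert's formula *)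

Lemma addF2 (x : 'F_2) : x + x = 0.
Proof. by apply/val_inj; case: x => [[|[|]]]. Qed.

Lemma addF2_eq0 (x y : 'F_2) : x + y = 0 <-> x = y.
Proof.
split=> [|->]; last exact: addF2.
by move/(congr1 (+%R x)); rewrite addrA addF2 add0r addr0.
Qed.

(** Mod 2 the sum over the four neighbours is also the difference of the second differences in X and
    in Y, that is, the wave operator. *)
Definition laplacian (V : int -> int -> 'F_2) (X Y : int) : 'F_2 :=
  V (X + 1) Y + V (X - 1) Y + (V X (Y + 1) + V X (Y - 1)).

Section Wave.
Variable W : int -> int -> 'F_2.
Hypothesis W_wave : forall X Y, laplacian W X Y = 0.
Hypothesis W_even : forall X Y : int, W (- X) Y = W X Y.
Hypothesis W_row0 : forall X, W X 0 = 0.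
Hypothesis W_col0 : forall Y, W 0 Y = 0.

(** The recurrence forces d'Alembert's formula on row 1. It links arguments of equal parity only,
    and both chains start from the free choice 0. *)
Fixpoint profile_nat (n : nat) : 'F_2 :=
  if n is n'.+2 then profile_nat n' + W n'.+1%:Z 1 else 0.

Definition profile (X : int) : 'F_2 := profile_nat `|X|%N.

Lemma profileN X : profile (- X) = profile X.
Proof. by rewrite /profile abszN. Qed.

Lemma profile_step X : profile (X + 1) + profile (X - 1) = W X 1.
Proof.
have pos (n : nat) : profile (n%:Z + 1) + profile (n%:Z - 1) = W n%:Z 1.
  (* At X = 0 both terms are the profile at 1, since it is even; they cancel, in accordance with the
     zero column. *)
  case: n => [|n]; first by rewrite W_col0; apply: addF2.
  have -> : n.+1%:Z + 1 = n.+2%:Z by lia.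
  have -> : n.+1%:Z - 1 = n%:Z by lia.
  by rewrite /profile !absz_nat /= addrAC addF2 add0r.
have [n [->|->]] : exists n : nat, X = n%:Z \/ X = - n%:Z.
  by exists `|X|%N; lia.
- exact: pos.
rewrite W_even -pos addrC -[in LHS]profileN -[profile (- _ + 1)]profileN.
by rewrite !opprD !opprK.
Qed.

(** Two consecutive rows determine the next one, and both sides agree on rows 0 and 1. *)
Lemma dAlembert X (n : nat) : W X n%:Z = profile (X + n%:Z) + profile (X - n%:Z).
Proof.
suff [] : (forall X, W X n%:Z = profile (X + n%:Z) + profile (X - n%:Z)) /\
  (forall X, W X n.+1%:Z = profile (X + n.+1%:Z) + profile (X - n.+1%:Z)) by [].
elim: n => {X} [|n [IH0 IH1]]; split=> // X.
- by rewrite W_row0 addr0 addF2.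
- by rewrite profile_step.
have := W_wave X n.+1%:Z; rewrite /laplacian.
have -> : n.+1%:Z - 1 = n%:Z by lia.
have -> : n.+1%:Z + 1 = n.+2%:Z by lia.
rewrite IH0 !IH1.
have -> : X + 1 + n.+1%:Z = X + n.+2%:Z by lia.
have -> : X - 1 + n.+1%:Z = X + n%:Z by lia.
have -> : X + 1 - n.+1%:Z = X - n%:Z by lia.
have -> : X - 1 - n.+1%:Z = X - n.+2%:Z by lia.
move: (W _ _) (profile _) (profile _) (profile _) (profile _) => w p q r s.
(* The profile values at X + n and X - n occur twice and cancel; the new value of W and the profile
   at X + n + 2 and X - n - 2 remain. *)
move/eqP; rewrite (AC ((2*2)*(1*2)) (5*(1*4)*(3*6)*(2*7))) /= !addF2 !addr0.
by move/eqP/addF2_eq0.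
Qed.

End Wave.

(** * Standing waves, their zero lines and their symmetries *)

Definition standing (a : int -> 'F_2) (X Y : int) : 'F_2 := a (X + Y) + a (X - Y).

(** The values of [a] at X + Y + 1, X + Y - 1, X - Y + 1 and X - Y - 1 each occur twice. *)
Lemma standing_wave a X Y : laplacian (standing a) X Y = 0.
Proof.
rewrite /laplacian /standing.
have -> : X + (Y + 1) = X + 1 + Y by lia.
have -> : X + (Y - 1) = X - 1 + Y by lia.
have -> : X - (Y + 1) = X - 1 - Y by lia.
have -> : X - (Y - 1) = X + 1 - Y by lia.
by rewrite [X in _ + X]addrACA [a (X - 1 - Y) + _]addrC -[X in _ + X]addrACA addF2.
Qed.

Section Standing.
Variables (a : int -> 'F_2) (g : nat).
Hypothesis a_even : forall X : int, a (- X) = a X.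
Hypothesis a_per : periodic a (2 * g%:Z).

Lemma standing_row (k X : int) : standing a X (k * g%:Z) = 0.
Proof.
rewrite /standing -[a (X - _)](periodic_mul k a_per).
rewrite (_ : X - _ + _ = X + k * g%:Z); [exact: addF2 | lia].
Qed.

Lemma standing_sym X Y : standing a X Y = standing a Y X.
Proof.
by rewrite /standing addrC -[a (X - Y)]a_even opprB [X + Y]addrC addrC.
Qed.

Lemma standing_col (k Y : int) : standing a (k * g%:Z) Y = 0.
Proof. by rewrite standing_sym standing_row. Qed.

(** Reflection in the line Y = k g exchanges X + Y and X - Y up to a multiple of the period 2g. *)
Lemma standing_mirror (k X Y : int) :
  standing a X (k * (2 * g%:Z) - Y) = standing a X Y.
Proof.
rewrite /standing addrC; congr (_ + _).
  rewrite -[in LHS](periodic_mul k a_per); congr a; lia.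
rewrite -[in RHS](periodic_mul k a_per); congr a; lia.
Qed.

Lemma standingN X Y : standing a X (- Y) = standing a X Y.
Proof. by rewrite /standing opprK addrC. Qed.

Hypothesis g_gt0 : (0 < g)%N.

Lemma standing_foldr X Y : standing a X (fold g Y)%:Z = standing a X Y.
Proof.
have [q [_ e]] := foldP g_gt0 Y; move: (fold g Y) e => f [] ->; symmetry.
  by rewrite -[in LHS](opprK f%:Z) standing_mirror standingN.
exact: standing_mirror.
Qed.

Lemma standing_fold X Y :
  standing a (fold g X)%:Z (fold g Y)%:Z = standing a X Y.
Proof. by rewrite standing_foldr standing_sym standing_foldr standing_sym. Qed.

End Standing.

(** * Solutions on a rectangle with zero boundary are standing waves *)

Section Unfold.
Variables (M N : nat) (V : int -> int -> 'F_2).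
Hypotheses (M_gt0 : (0 < M)%N) (N_gt0 : (0 < N)%N).
Hypothesis V_wave : forall X Y : int,
  0 < X < M%:Z -> 0 < Y < N%:Z -> laplacian V X Y = 0.
Hypotheses (V_row0 : forall X, V X 0 = 0) (V_rowN : forall X, V X N%:Z = 0).
Hypotheses (V_col0 : forall Y, V 0 Y = 0) (V_colM : forall Y, V M%:Z Y = 0).

Definition unfolded (X Y : int) : 'F_2 := V (fold M X)%:Z (fold N Y)%:Z.

Lemma unfolded_row X Y : fold N Y = 0%N \/ fold N Y = N -> unfolded X Y = 0.
Proof. by rewrite /unfolded => -[] ->; rewrite ?V_row0 ?V_rowN. Qed.

Lemma unfolded_col X Y : fold M X = 0%N \/ fold M X = M -> unfolded X Y = 0.
Proof. by rewrite /unfolded => -[] ->; rewrite ?V_col0 ?V_colM. Qed.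

(** On a fold line the two neighbours along the line carry 0 and the two across it are mirror images
    that cancel. Elsewhere folding carries the four neighbours to those of the folded point,
    possibly swapping opposite ones. *)
Lemma unfolded_wave X Y : laplacian unfolded X Y = 0.
Proof.
have dec (K : nat) Z : (0 < K)%N ->
    (0 < fold K Z < K)%N \/ (fold K Z = 0%N \/ fold K Z = K).
  by move=> K0; have := fold_le K0 Z; lia.
have [hX|hX] := dec M X M_gt0; last first.
  rewrite /laplacian !(unfolded_col _ hX) !addr0.
  by rewrite /unfolded (fold_turn M_gt0 hX) addF2.
have [hY|hY] := dec N Y N_gt0; last first.
  rewrite /laplacian !(unfolded_row _ hY) !add0r.
  by rewrite /unfolded (fold_turn N_gt0 hY) addF2.
have := @V_wave (fold M X)%:Z (fold N Y)%:Z ltac:(lia) ltac:(lia).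
rewrite /laplacian /unfolded.
have step (K : nat) Z : (0 < fold K Z < K)%N ->
  (fold K Z)%:Z + 1 = (fold K Z).+1%:Z /\ (fold K Z)%:Z - 1 = (fold K Z).-1%:Z.
  by lia.
have [-> ->] := step _ _ hX; have [-> ->] := step _ _ hY.
have [[-> ->]|[-> ->]] := fold_step M_gt0 hX;
  have [[-> ->]|[-> ->]] := fold_step N_gt0 hY => // <-.
- by congr (_ + _); rewrite addrC.
- by congr (_ + _); rewrite addrC.
- by congr (_ + _); rewrite addrC.
Qed.

Lemma standing_of_wave : exists a : int -> 'F_2,
  [/\ forall X : int, a (- X) = a X, periodic a (2 * (gcdn M N)%:Z)
    & forall X Y : int, 0 <= X <= M%:Z -> 0 <= Y <= N%:Z -> V X Y = standing a X Y].
Proof.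
have col0 Y : unfolded 0 Y = 0 by apply: unfolded_col; left; rewrite /fold mod0z.
have row0 X : unfolded X 0 = 0 by apply: unfolded_row; left; rewrite /fold mod0z.
have even X Y : unfolded (- X) Y = unfolded X Y by rewrite /unfolded foldN.
pose a := profile unfolded.
have sol X (n : nat) : unfolded X n%:Z = a (X + n%:Z) + a (X - n%:Z).
  exact: (dAlembert unfolded_wave even row0 col0).
have a_even (X : int) : a (- X) = a X by apply: profileN.
(* The zero row Y = N, read at X + N, says a (X + 2N) = a X. *)
have perN : periodic a (2 * N%:Z).
  move=> X; have := sol (X + N%:Z) N.
  rewrite unfolded_row; last by right; rewrite fold_small.
  by move/esym/addF2_eq0; rewrite addrK => <-; congr a; lia.
(* The zero column X = M gives a (M + n) = a (M - n) for natural n; evenness turns the right side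
   into a (n - M) and also covers negative arguments. *)
have perM : periodic a (2 * M%:Z).
  have pos (n : nat) : a (M%:Z + n%:Z) = a (n%:Z - M%:Z).
    have := sol M%:Z n; rewrite unfolded_col; last by right; rewrite fold_small.
    by move/esym/addF2_eq0 => ->; rewrite -a_even opprB.
  have step (Z : int) : a (M%:Z + Z) = a (Z - M%:Z).
    have [n [->|->]] : exists n : nat, Z = n%:Z \/ Z = - n%:Z.
      by exists (absz Z); lia.
    - exact: pos.
    rewrite -[LHS]a_even -[RHS]a_even !opprD !opprK addrC -pos.
    by congr a; lia.
  move=> X; have -> : X + 2 * M%:Z = M%:Z + (X + M%:Z) by lia.
  by rewrite step addrK.
exists a; split=> [//||X Y hX hY]; first exact: periodic_gcd.
have [x eX] : exists x : nat, X = x%:Z by exists `|X|%N; lia.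
have [y eY] : exists y : nat, Y = y%:Z by exists `|Y|%N; lia.
by rewrite /standing eY -sol /unfolded eX !fold_small //; lia.
Qed.

End Unfold.

(** * Vectors on a graph, extended by zero to the plane *)

Lemma odd_shift (x y : nat) : odd (absz (x.+1%:Z + y.+1%:Z)) = odd (x + y).
Proof.
have -> : absz (x.+1%:Z + y.+1%:Z) = (x + y).+2 by lia.
by rewrite /= negbK.
Qed.

Section Value.
Variables (p q : nat) (b : bool) (S : {set point p q}).

(* Coordinates are shifted by one, so that the zero lines of a kernel vector
   pass through the multiples of [c.+1]. *)
Definition value (u : colored_fun b S) (X Y : int) : 'F_2 :=
  \sum_(P : colored b S | ((val P).1.+1%:Z == X) && ((val P).2.+1%:Z == Y)) u P.

Lemma value_at u (P : colored b S) :
  value u (val P).1.+1%:Z (val P).2.+1%:Z = u P.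
Proof. by rewrite /value (big_pred1 P). Qed.

Lemma value_out u (X Y : int) :
  (forall P : colored b S, X = (val P).1.+1%:Z -> Y = (val P).2.+1%:Z -> False) ->
  value u X Y = 0.
Proof.
move=> H; rewrite /value big_pred0 // => P; apply/negbTE/negP => /andP[/eqP h1 /eqP h2].
exact: (H P).
Qed.

Lemma value_color u (X Y : int) : odd (absz (X + Y)) != b -> value u X Y = 0.
Proof.
move=> h; apply: value_out => P eX eY; case/andP: (valP P) => _ /eqP.
by move=> e; move: h; rewrite eX eY odd_shift => /eqP; apply.
Qed.

(** Positions outside S contribute 0 to the four-neighbour sum, so the induced subgraph needs no
    separate treatment. *)
Lemma adj_map_value u (w : colored (~~ b) S) :
  adj_map b S u w = laplacian (value u) (val w).1.+1%:Z (val w).2.+1%:Z.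
Proof.
have valueE X Y : value u X Y = \sum_(P : colored b S)
    if ((val P).1.+1%:Z == X) && ((val P).2.+1%:Z == Y) then u P : 'F_2 else 0.
  by rewrite /value big_mkcond.
rewrite adj_mapE /laplacian !valueE -!big_split [LHS]big_mkcond /=.
apply: eq_bigr => P _; rewrite /adjacent.
case: (val P) => [[x ?] [y ?]]; case: (val w) => [[x' ?] [y' ?]] /=.
(* The vertex is the right, left, upper or lower neighbour of [w]; these cases exclude one another
   and together amount to adjacency. *)
set A := _ && _; set B := _ && _; set C := _ && _; set D := _ && _.
have -> : (`|x%:Z - x'%:Z| + `|y%:Z - y'%:Z| == 1) = [|| A, B, C | D].
  by rewrite /A /B /C /D; lia.
have : [&& ~~ (A && B), ~~ (A && C), ~~ (A && D), ~~ (B && C), ~~ (B && D)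
         & ~~ (C && D)] by rewrite /A /B /C /D; lia.
by case: A; case: B; case: C; case: D => //= _; rewrite ?addr0 ?add0r.
Qed.

Lemma kernelP u : reflect
  (forall w : colored (~~ b) S,
     laplacian (value u) (val w).1.+1%:Z (val w).2.+1%:Z = 0)
  (u \in lker (adj_map b S)).
Proof.
rewrite memv_ker; apply: (iffP eqP) => [e w|H].
  by rewrite -adj_map_value e ffunE.
by apply/ffunP => w; rewrite ffunE adj_map_value H.
Qed.

End Value.

(** * Kernel vectors and even periodic standing waves *)

Section Kernel.
Variables (p q : nat) (b : bool).
Implicit Types u : colored_fun b [set: point p q].

Lemma point_at (c : bool) (X Y : int) :
  0 < X < p.+1%:Z -> 0 < Y < q.+1%:Z -> odd (absz (X + Y)) = c ->
  exists P : colored c [set: point p q],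
    X = (val P).1.+1%:Z /\ Y = (val P).2.+1%:Z.
Proof.
move=> hX hY hc.
have ltX : ((absz X).-1 < p)%N by lia.
have ltY : ((absz Y).-1 < q)%N by lia.
have hP : ((Ordinal ltX, Ordinal ltY) \in [set: point p q]) &&
    (color (Ordinal ltX, Ordinal ltY) == c).
  by rewrite inE /color /=; apply/eqP; rewrite -hc; lia.
by exists (Sub (Ordinal ltX, Ordinal ltY) hP); rewrite SubK /=; lia.
Qed.

(** The comparison is limited to color [b]: on the other color [value u] is 0, whereas V may not
    be. *)
Lemma value_ext (u : colored_fun b [set: point p q]) (V : int -> int -> 'F_2) :
  (forall Y, V 0 Y = 0) -> (forall Y, V p.+1%:Z Y = 0) ->
  (forall X, V X 0 = 0) -> (forall X, V X q.+1%:Z = 0) ->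
  (forall P : colored b [set: point p q],
     u P = V (val P).1.+1%:Z (val P).2.+1%:Z) ->
  forall X Y : int, 0 <= X <= p.+1%:Z -> 0 <= Y <= q.+1%:Z ->
    odd (absz (X + Y)) = b -> value u X Y = V X Y.
Proof.
move=> V0 Vp W0 Wq H X Y hX hY hb.
have : (X = 0 \/ X = p.+1%:Z \/ Y = 0 \/ Y = q.+1%:Z) \/
   (0 < X < p.+1%:Z) && (0 < Y < q.+1%:Z) by lia.
case=> [out|/andP[hX1 hY1]]; last first.
  have [P [eX eY]] := point_at hX1 hY1 hb.
  by rewrite eX eY value_at H.
rewrite value_out; first by case: out => [|[|[|]]] ->.
by move=> P eX eY; have := ltn_ord (val P).1; have := ltn_ord (val P).2; lia.
Qed.

Lemma kernel_standing u : u \in lker (adj_map b [set: point p q]) ->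
  exists a : int -> 'F_2,
  [/\ forall X : int, a (- X) = a X, periodic a (2 * (gcdn p.+1 q.+1)%:Z)
    & forall X Y : int, 0 <= X <= p.+1%:Z -> 0 <= Y <= q.+1%:Z ->
        value u X Y = standing a X Y].
Proof.
move/kernelP => H; apply: standing_of_wave => //.
- move=> X Y hX hY.
  (* At points of color [~~ b] this is the kernel equation; at points of color [b] all four
     neighbours have the other color and carry 0. *)
  have [hb|hb] := eqVneq (odd (absz (X + Y))) (~~ b).
    by have [P [-> ->]] := point_at hX hY hb; apply: H.
  by rewrite /laplacian !value_color ?addr0 //; move: hb; case: (b); lia.
- by move=> X; apply: value_out => P; lia.
- move=> X; apply: value_out => P; have := ltn_ord (val P).2; lia.
- by move=> X; apply: value_out => P; lia.
- move=> X; apply: value_out => P; have := ltn_ord (val P).1; lia.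
Qed.

(** The frame around the rectangle lies on multiples of the gcd, where the wave vanishes as the zero
    extension of [u] does. The equation at [w] involves neighbours of color [b] only, where the two
    agree. *)
Lemma standing_kernel u (a : int -> 'F_2) :
  (forall X : int, a (- X) = a X) -> periodic a (2 * (gcdn p.+1 q.+1)%:Z) ->
  (forall P : colored b [set: point p q],
     u P = standing a (val P).1.+1%:Z (val P).2.+1%:Z) ->
  u \in lker (adj_map b [set: point p q]).
Proof.
move=> a_even a_per H; apply/kernelP => w.
have [k ek] : exists k : int, p.+1%:Z = k * (gcdn p.+1 q.+1)%:Z.
  by have /dvdnP [k ek] := dvdn_gcdl p.+1 q.+1; exists k%:Z; rewrite {1}ek; lia.
have [l el] : exists l : int, q.+1%:Z = l * (gcdn p.+1 q.+1)%:Z.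
  by have /dvdnP [l el] := dvdn_gcdr p.+1 q.+1; exists l%:Z; rewrite {1}el; lia.
have ext : forall X Y : int, 0 <= X <= p.+1%:Z -> 0 <= Y <= q.+1%:Z ->
    odd (absz (X + Y)) = b -> value u X Y = standing a X Y.
  apply: value_ext => // Z; rewrite ?ek ?el.
  - by rewrite -(standing_col a_even a_per 0 Z) mul0r.
  - by rewrite (standing_col a_even a_per).
  - by rewrite -(standing_row a_per 0 Z) mul0r.
  - by rewrite (standing_row a_per).
case/andP: (valP w) => _ /eqP; rewrite /color => hw.
move: (val w) hw => [[x ltx] [y lty]] /= hw.
by rewrite -(standing_wave a x.+1%:Z y.+1%:Z) /laplacian !ext //; lia.
Qed.

End Kernel.

Lemma point_bounds p q (P : point p q) :
  (0 <= P.1.+1%:Z <= p.+1%:Z) && (0 <= P.2.+1%:Z <= q.+1%:Z).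
Proof. by have := ltn_ord P.1; have := ltn_ord P.2; lia. Qed.

Lemma restrictionE p q b (S : {set point p q})
    (u : colored_fun b [set: point p q]) (P : colored b S) :
  restriction S u P = value u (val P).1.+1%:Z (val P).2.+1%:Z.
Proof. by rewrite ffunE -value_at SubK. Qed.

(** * The kernel dimension depends only on the gcd *)

Section Transfer.
Variables (p q p' q' : nat) (b : bool).
Hypothesis eq_gcd : gcdn p.+1 q.+1 = gcdn p'.+1 q'.+1.
Local Notation g := (gcdn p.+1 q.+1).

(* A kernel vector is determined by its values on [0, g]^2, and folding the
   points of any rectangle with the same g into this square yields a kernel
   vector of that rectangle. *)
Definition transfer (u : colored_fun b [set: point p q]) :
    colored_fun b [set: point p' q'] :=
  [ffun P : colored b [set: point p' q'] =>
     value u (fold g (val P).1.+1)%:Z (fold g (val P).2.+1)%:Z].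

Fact transfer_is_linear : linear transfer.
Proof.
move=> k u v; apply/ffunP=> P; rewrite !ffunE /value scaler_sumr -big_split /=.
by apply: eq_bigr => Q _; rewrite !ffunE.
Qed.

HB.instance Definition _ :=
  GRing.isLinear.Build 'F_2 (colored_fun b [set: point p q])
    (colored_fun b [set: point p' q']) _ transfer transfer_is_linear.

Let g_gt0 : (0 < g)%N. Proof. by rewrite gcdn_gt0. Qed.
Let g_le1 : (g <= p.+1)%N. Proof. by rewrite dvdn_leq ?dvdn_gcdl. Qed.
Let g_le2 : (g <= q.+1)%N. Proof. by rewrite dvdn_leq ?dvdn_gcdr. Qed.
Let g_le1' : (g <= p'.+1)%N. Proof. by rewrite eq_gcd dvdn_leq ?dvdn_gcdl. Qed.
Let g_le2' : (g <= q'.+1)%N. Proof. by rewrite eq_gcd dvdn_leq ?dvdn_gcdr. Qed.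

Lemma value_fold (u : colored_fun b [set: point p q]) (a : int -> 'F_2) (X Y : int) :
  (forall X : int, a (- X) = a X) -> periodic a (2 * g%:Z) ->
  (forall X Y : int, 0 <= X <= p.+1%:Z -> 0 <= Y <= q.+1%:Z ->
     value u X Y = standing a X Y) ->
  value u (fold g X)%:Z (fold g Y)%:Z = standing a X Y.
Proof.
move=> a_even a_per H; have hX := fold_le g_gt0 X; have hY := fold_le g_gt0 Y.
by rewrite H ?standing_fold //; lia.
Qed.

(** Folding into the square of side g preserves a standing wave, so [transfer u] samples the same
    wave on the other rectangle. *)
Lemma transfer_kernel u : u \in lker (adj_map b [set: point p q]) ->
  transfer u \in lker (adj_map b [set: point p' q']).
Proof.
move=> /kernel_standing[a [a_even a_per H]].
apply: (@standing_kernel _ _ _ _ a) => //; first by rewrite -eq_gcd.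
by move=> P; rewrite ffunE (value_fold _ _ a_even a_per H).
Qed.

Lemma transfer_inj u : u \in lker (adj_map b [set: point p q]) ->
  transfer u = 0 -> u = 0.
Proof.
move=> /kernel_standing[a [a_even a_per H]] u0.
apply/ffunP => P; rewrite ffunE -value_at.
have /andP[hX hY] := point_bounds (val P); rewrite H // {hX hY}.
(* It remains to show that [value u] vanishes on the square from 0 to g: by color, on its sides as
   zero lines, and inside by [u0]. *)
rewrite -(value_fold _ _ a_even a_per H).
move: (fold_le g_gt0 (val P).1.+1) (fold_le g_gt0 (val P).2.+1).
move: (fold _ _) (fold _ _) => y x hx hy.
have [hb|hb] := eqVneq (odd (absz (x%:Z + y%:Z))) b; last first.
  by rewrite value_color.
have : (x = 0 \/ x = g \/ y = 0 \/ y = g)%N \/ ((0 < x < g)%N && (0 < y < g)%N) by lia.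
case=> [e|/andP[hx' hy']].
  rewrite H; [|lia|lia].
  case: e => [|[|[|]]] ->.
  - by rewrite -[0%N%:Z](mul0r g%:Z) (standing_col a_even a_per).
  - by rewrite -[g%:Z]mul1r (standing_col a_even a_per).
  - by rewrite -[0%N%:Z](mul0r g%:Z) (standing_row a_per).
  - by rewrite -[g%:Z]mul1r (standing_row a_per).
(* As g is at most p' + 1 and q' + 1, an interior point of the square is also a vertex of the other
   rectangle, and folding fixes it. *)
have [Q [eX eY]] := @point_at p' q' b x y ltac:(lia) ltac:(lia) hb.
have := congr1 (fun f : colored_fun b _ => f Q) u0.
by rewrite /= !ffunE -eX -eY !fold_small.
Qed.

Lemma dim_kernel_le : (\dim (lker (adj_map b [set: point p q])) <=
                       \dim (lker (adj_map b [set: point p' q'])))%N.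
Proof.
set K := lker _; set K' := lker _.
rewrite -(@limg_dim_eq _ _ _ (linfun transfer) K).
  apply/dimvS/subvP => _ /memv_imgP[u uK ->]; rewrite lfunE.
  exact: transfer_kernel.
apply/eqP; rewrite -subv0; apply/subvP => u; rewrite memv_cap memv0 memv_ker lfunE.
by case/andP=> uK /eqP /(transfer_inj uK) ->.
Qed.

End Transfer.

Lemma dim_kernel_gcd (p q p' q' : nat) (b : bool) :
  gcdn p.+1 q.+1 = gcdn p'.+1 q'.+1 ->
  \dim (lker (adj_map b [set: point p q])) =
  \dim (lker (adj_map b [set: point p' q'])).
Proof. by move=> e; apply/eqP; rewrite eqn_leq !dim_kernel_le. Qed.

(** * The grid, the fundamental squares and their mirror images *)

Section Fundamental.
Variables (m n : nat) (b : bool).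
Local Notation c := (csize m n).

Lemma csizeS : c.+1 = gcdn m.+1 n.+1.
Proof. by rewrite /csize prednK // gcdn_gt0. Qed.

Variable v : colored_fun b [set: point m n].
Hypothesis v_ker : v \in lker (adj_map b [set: point m n]).

Let v_standing : exists a : int -> 'F_2,
  [/\ forall X : int, a (- X) = a X, periodic a (2 * c.+1%:Z)
    & forall X Y : int, 0 <= X <= m.+1%:Z -> 0 <= Y <= n.+1%:Z ->
        value v X Y = standing a X Y].
Proof. by rewrite csizeS; apply: kernel_standing. Qed.

Lemma value_grid_line (k X Y : int) : 0 <= X <= m.+1%:Z -> 0 <= Y <= n.+1%:Z ->
  X = k * c.+1%:Z \/ Y = k * c.+1%:Z -> value v X Y = 0.
Proof.
have [a [a_even a_per H]] := v_standing.
move=> hX hY e; rewrite H //; case: e => ->.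
  exact: standing_col.
exact: standing_row.
Qed.

Lemma kernel_grid0 (P : colored b [set: point m n]) : on_grid (val P) -> v P = 0.
Proof.
have /andP[h1 h2] := point_bounds (val P).
case=> k e; rewrite -value_at; apply: (@value_grid_line k) => //.
by case: e => e; [right|left]; rewrite intS e addrC subrK.
Qed.

(** The sides of the closed square are grid lines, where [v] already vanishes, so cutting [v] off
    outside the square changes nothing there. *)
Lemma value_restriction (k l : nat) (X Y : int) : square_fits m n k l ->
  (k * c.+1)%N%:Z <= X <= (k.+1 * c.+1)%N%:Z ->
  (l * c.+1)%N%:Z <= Y <= (l.+1 * c.+1)%N%:Z ->
  value (restriction (square m n k l) v) X Y = value v X Y.
Proof.
move=> /andP[fk fl] hX hY.
have [hb|hb] := eqVneq (odd (absz (X + Y))) b; last by rewrite !value_color.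
have : (X = k%:Z * c.+1%:Z \/ X = k.+1%:Z * c.+1%:Z \/
        Y = l%:Z * c.+1%:Z \/ Y = l.+1%:Z * c.+1%:Z) \/
   ((k * c.+1)%N%:Z < X < (k.+1 * c.+1)%N%:Z) &&
   ((l * c.+1)%N%:Z < Y < (l.+1 * c.+1)%N%:Z) by lia.
case=> [e|/andP[hX' hY']].
  have [d ed] : exists d : int, X = d * c.+1%:Z \/ Y = d * c.+1%:Z.
    by case: e => [|[|[|]]] ->; [exists k|exists k.+1|exists l|exists l.+1]; auto.
  rewrite (@value_grid_line d) ?value_out //; try lia.
  move=> P eX eY; case/andP: (valP P); rewrite inE => hP _.
  by move: (val P) hP eX eY e {ed} => [[x ?] [y ?]] /=; lia.
have [P [eX eY]] := @point_at m n b X Y ltac:(lia) ltac:(lia) hb.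
have PS : (val P \in square m n k l) && (color (val P) == b).
  case/andP: (valP P) => _ ->; rewrite inE andbT.
  by move: (val P) eX eY => [[x ?] [y ?]] /=; lia.
have := value_at (restriction (square m n k l) v) (Sub (val P) PS).
by rewrite restrictionE SubK -eX -eY.
Qed.

(** All four neighbours of a point of S lie in the closed square, so its equation in S is its
    equation in the whole graph. *)
Lemma kernel_square (S : {set point m n}) :
  fundamental S -> restriction S v \in lker (adj_map b S).
Proof.
case=> k [l [fit ->]]; apply/kernelP => w.
have hw := kernelP v v_ker (Sub (val w) (colored_inT w)).
rewrite SubK in hw; rewrite -hw /laplacian.
have : val w \in square m n k l by case/andP: (valP w).
rewrite inE; move: (val w) => [[x ?] [y ?]] /= hS.
by rewrite !value_restriction //; lia.
Qed.

Lemma row_mirror_kernel (y0 : nat) (S1 S2 : {set point m n}) :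
  separated_by_row y0 S1 S2 ->
  forall P : colored b [set: point m n], val P \in S1 ->
  exists P' : colored b [set: point m n],
    [/\ val P' \in S2, row_mirror y0 (val P) (val P') & v P = v P'].
Proof.
case=> k [l [/andP[fk fl] /andP[_ fl'] -> S12]] P PS1.
have ey0 : (l.+1 * c.+1 = (l.+1 * c.+1).-1.+1)%N by [].
have [a [a_even a_per H]] := v_standing.
(* In shifted coordinates the mirror row is y0 + 1 = (l + 1)(c + 1), so y' = 2 y0 - y becomes Y' = 2
   (l + 1)(c + 1) - Y. *)
pose X := (val P).1.+1%:Z; pose Y := l.+1%:Z * (2 * c.+1%:Z) - (val P).2.+1%:Z.
(* A bound valid for both orders of the two squares; it keeps the reflected point inside the
   graph. *)
have eS1 : (k * c.+1 <= (val P).1 < k * c.+1 + c)%N &&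
    (l * c.+1 <= (val P).2 < l.+1 * c.+1 + c)%N.
  by case: S12 PS1 => -[-> _]; rewrite inE => /andP[-> /=]; lia.
have hb : odd (absz (X + Y)) = b.
  case/andP: (valP P) => _ /eqP <-; rewrite /color /X /Y.
  by move: (nat_of_ord _) (nat_of_ord _) eS1 => x y; lia.
have [P' [eX eY]] := @point_at m n b X Y ltac:(lia) ltac:(lia) hb.
exists P'; split.
- case: S12 PS1 => -[-> ->]; rewrite !inE; move: eX eY; rewrite /X /Y;
  move: (nat_of_ord (val P).1) (nat_of_ord (val P).2) (nat_of_ord (val P').1)
      (nat_of_ord (val P').2) => x y x' y' *; lia.
- split; first by apply: ord_inj; case: eX.
  move: eX eY ey0; rewrite /X /Y; move: (l.+1 * c.+1)%N.-1 => z.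
  by move: (nat_of_ord (val P).1) (nat_of_ord (val P).2) (nat_of_ord (val P').1)
    (nat_of_ord (val P').2) => x y x' y' *; lia.
have /andP[h1 h2] := point_bounds (val P).
have /andP[h3 h4] := point_bounds (val P').
by rewrite -!value_at !H // -eX -eY standing_mirror.
Qed.

Lemma column_mirror_kernel (x0 : nat) (S1 S2 : {set point m n}) :
  separated_by_column x0 S1 S2 ->
  forall P : colored b [set: point m n], val P \in S1 ->
  exists P' : colored b [set: point m n],
    [/\ val P' \in S2, column_mirror x0 (val P) (val P') & v P = v P'].
Proof.
case=> k [l [/andP[fk fl] /andP[fk' _] -> S12]] P PS1.
have ex0 : (k.+1 * c.+1 = (k.+1 * c.+1).-1.+1)%N by [].
have [a [a_even a_per H]] := v_standing.
pose X := k.+1%:Z * (2 * c.+1%:Z) - (val P).1.+1%:Z; pose Y := (val P).2.+1%:Z.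
have eS1 : (k * c.+1 <= (val P).1 < k.+1 * c.+1 + c)%N &&
    (l * c.+1 <= (val P).2 < l * c.+1 + c)%N.
  by case: S12 PS1 => -[-> _]; rewrite inE => /andP[+ ->]; rewrite andbT;
    move: (nat_of_ord _) => x; lia.
have hb : odd (absz (X + Y)) = b.
  case/andP: (valP P) => _ /eqP <-; rewrite /color /X /Y.
  by move: (nat_of_ord _) (nat_of_ord _) eS1 => x y; lia.
have [P' [eX eY]] := @point_at m n b X Y ltac:(lia) ltac:(lia) hb.
exists P'; split.
- case: S12 PS1 => -[-> ->]; rewrite !inE; move: eX eY; rewrite /X /Y;
  move: (nat_of_ord (val P).1) (nat_of_ord (val P).2) (nat_of_ord (val P').1)
      (nat_of_ord (val P').2) => x y x' y' *; lia.
- split; last by apply: ord_inj; case: eY.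
  move: eX eY ex0; rewrite /X /Y; move: (k.+1 * c.+1)%N.-1 => z.
  by move: (nat_of_ord (val P).1) (nat_of_ord (val P).2) (nat_of_ord (val P').1)
    (nat_of_ord (val P').2) => x y x' y' *; lia.
have /andP[h1 h2] := point_bounds (val P).
have /andP[h3 h4] := point_bounds (val P').
(* Exchanging the coordinates of the wave reduces the column reflection to the row reflection. *)
rewrite -!value_at !H // -eX -eY standing_sym // [RHS]standing_sym //.
by rewrite standing_mirror.
Qed.

End Fundamental.

Theorem theorem3 (m n : nat) (hm : (1 <= m)%N) (hn : (1 <= n)%N) :
  (forall (b : bool) (v : colored_fun b [set: point m n]),
     v \in lker (adj_map b [set: point m n]) ->
     [/\ (* (i) *)
         forall P : colored b [set: point m n], on_grid (val P) -> v P = 0,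
         (* (ii) *)
         forall S : {set point m n}, fundamental S ->
           restriction S v \in lker (adj_map b S)
       & (* (iii) *)
         (forall (y0 : nat) (S1 S2 : {set point m n}),
            separated_by_row y0 S1 S2 ->
            forall P : colored b [set: point m n], val P \in S1 ->
            exists P' : colored b [set: point m n],
              [/\ val P' \in S2, row_mirror y0 (val P) (val P') & v P = v P']) /\
         (forall (x0 : nat) (S1 S2 : {set point m n}),
            separated_by_column x0 S1 S2 ->
            forall P : colored b [set: point m n], val P \in S1 ->
            exists P' : colored b [set: point m n],
              [/\ val P' \in S2, column_mirror x0 (val P) (val P') & v P = v P'])])
  /\ (* (iv) *)
  (\dim (lker (BW m n)) = \dim (lker (BW (csize m n) (csize m n))) /\
   \dim (lker (WB m n)) = \dim (lker (WB (csize m n) (csize m n)))).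
Proof.
split=> [b v v_ker|].
  split; first exact: kernel_grid0.
    exact: kernel_square.
  by split; [exact: row_mirror_kernel | exact: column_mirror_kernel].
by split; apply: dim_kernel_gcd; rewrite gcdnn csizeS.
Qed.
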